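(* Let $b \ge 1$ be an integer and let $d = 2b-1$. Then the hyperbanana $H_{d,b}$ is a Maxwell graph in dimension $d$.
   Context: All graphs are finite and simple. For a graph $G=(V,E)$ and $V'\subseteq V$, $E(V')$ denotes the set of edges in $E$ induced by $V'$ (both endpoints in $V'$). Maxwell graph: a graph $G=(V,E)$ is a Maxwell graph in dimension $d$ if (1) $|E| = d|V| - \binom{d+1}{2}$, and (2) $|E(V')| \le d|V'| - \binom{d+1}{2}$ for all $V'\subseteq V$ with $|V'|\ge d$. Banana bunch: for a positive integer $d$, the banana bunch $B_{d,b}$ is the graph obtained from a complete graph $K_d$ on $d$ vertices by adding $b$ new vertices (the banana vertices), each joined to all $d$ vertices of the $K_d$; there are no edges between banana vertices. Hyperbanana: $H_{d,b}$ is obtained from two copies of $B_{d,b}$ by identifying their banana vertices via a fixed bijection. Explicitly, the vertex set of $H_{d,b}$ is a disjoint union $V = V_1\cup V_2\cup U$ with $|V_1|=|V_2|=d$, $|U|=b$; its edges are all pairs inside $V_1$, all pairs inside $V_2$, and all pairs consisting of one vertex of $U$ and one vertex of $V_1\cup V_2$. *)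

(* Defs.v *)
From HB Require Import structures.
From mathcomp Require Import all_boot all_order all_algebra.
Set Implicit Arguments. Unset Strict Implicit. Unset Printing Implicit Defensive.

Import Order.TTheory GRing.Theory Num.Theory.

Record sgraph := SGraph {
  vertex :> finType;
  adj : rel vertex;
  adj_sym : symmetric adj;
  adj_irr : irreflexive adj
}.

(* An edge is the unordered pair of its endpoints. *)
Definition edges (G : sgraph) : {set {set G}} :=
  [set [set x; y] | x in [set: G], y in [set: G] & adj x y].

Definition induced_edges (G : sgraph) (A : {set G}) : {set {set G}} :=
  [set e in edges G | e \subset A].

(* The counts are compared in int: d * #|V| - 'C(d.+1, 2) can be negative when
   #|V| < d, and natural subtraction would truncate it to 0. *)
Definition maxwell_graph (d : nat) (G : sgraph) : Prop :=
  (#|edges G|%:Z = d%:Z * #|G|%:Z - 'C(d.+1, 2)%:Z)%R /\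
  (forall A : {set G}, d <= #|A| ->
     (#|induced_edges A|%:Z <= d%:Z * #|A|%:Z - 'C(d.+1, 2)%:Z)%R).

Definition banana_adj (d b : nat) : rel ('I_d + 'I_b) := fun x y =>
  match x, y with
  | inl i, inl j => i != j
  | inr _, inr _ => false
  | _, _ => true
  end.

Lemma banana_adj_sym d b : symmetric (@banana_adj d b).
Proof. by move=> [i|u] [j|v] //=; rewrite eq_sym. Qed.

Lemma banana_adj_irr d b : irreflexive (@banana_adj d b).
Proof. by move=> [i|u] //=; rewrite eqxx. Qed.

Definition banana (d b : nat) : sgraph :=
  SGraph (@banana_adj_sym d b) (@banana_adj_irr d b).

(* inl (s, i) is vertex i of the s-th copy of K_d (s : bool, giving V_1 and
   V_2); inr u is a banana vertex, shared by the two banana bunches. *)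
Definition hyperbanana_adj (d b : nat) : rel (bool * 'I_d + 'I_b) := fun x y =>
  match x, y with
  | inl (s, i), inl (t, j) => (s == t) && (i != j)
  | inr _, inr _ => false
  | _, _ => true
  end.

Lemma hyperbanana_adj_sym d b : symmetric (@hyperbanana_adj d b).
Proof. by move=> [[s i]|u] [[t j]|v] //=; rewrite eq_sym (eq_sym i). Qed.

Lemma hyperbanana_adj_irr d b : irreflexive (@hyperbanana_adj d b).
Proof. by move=> [[s i]|u] //=; rewrite !eqxx. Qed.

Definition hyperbanana (d b : nat) : sgraph :=
  SGraph (@hyperbanana_adj_sym d b) (@hyperbanana_adj_irr d b).

Definition glue (d b : nat) (s : bool) (x : banana d b) : hyperbanana d b :=
  match x with inl i => inl (s, i) | inr u => inr u end.

(* hyperbanana d b is the union of two copies of banana d b that share exactly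
   their banana vertices. *)
Lemma hyperbanana_glueP (d b : nat) (x y : hyperbanana d b) :
  adj x y <-> exists s (u v : banana d b),
    [/\ x = glue s u, y = glue s v & adj u v].
Proof.
split=> [|[s [u [v [-> -> ]]]]]; last first.
  by case: u v => [i|u] [j|v] //=; rewrite eqxx.
case: x y => [[s i]|u] [[t j]|v] //=.
- by case/andP=> /eqP <- ij; exists s, (inl i), (inl j).
- by exists s, (inl i), (inr v).
- by exists t, (inr u), (inl j).
Qed.

(* Main.v *)
Require Import Defs.
From mathcomp Require Import all_boot all_order all_algebra.
From mathcomp Require Import zify ring.

(** Let [A] be a set of vertices of the hyperbanana with [p] and [q] vertices
    in the two complete graphs and [u] banana vertices.  Counting ordered
    adjacent pairs ([card_induced_edgesD], [hyperbanana_card_induced_edgesD])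
    shows that twice the number of edges induced by [A] is
      [p (p - 1) + q (q - 1) + 2 u (p + q)].
    What remains ([hyperbanana_slack_ge0]) is that
      [S := 2 d (p + q + u) - d (d + 1) - p (p - 1) - q (q - 1) - 2 u (p + q)],
    twice the slack in the Maxwell bound, is nonnegative when [p, q <= d],
    [u <= b] and [p + q + u >= d].  It is affine in [u] with slope
    [2 (d - p - q)], so it is enough to look at one end of the range of [u]:
    - if [p + q >= d] the worst case is [u = b], where [d = 2 b - 1] turns [S]
      into [p (d - p) + q (d - q)];
    - if [p + q < d] the worst case is [u = d - p - q], where [A] has only [d]
      vertices and [S] is twice the number of non-adjacent pairs in [A].
    For the whole vertex set, [p = q = d] and [u = b], the first expression
    vanishes, which is the exact edge count. *)

Set Implicit Arguments.
Unset Strict Implicit.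
Unset Printing Implicit Defensive.

Import Order.TTheory GRing.Theory Num.Theory.

Lemma induced_edgesT (G : sgraph) : induced_edges [set: G] = edges G.
Proof. by apply/setP=> e; rewrite inE subsetT andbT. Qed.

(** Handshake formula: an edge inside [A] is the image of exactly two ordered
    pairs, which differ because adjacency is irreflexive. *)
Lemma card_induced_edgesD (G : sgraph) (A : {set G}) :
  #|induced_edges A|.*2 = \sum_(x in A) \sum_(y in A) adj x y.
Proof.
pose D := [set z : G * G | [&& z.1 \in A, z.2 \in A & adj z.1 z.2]].
pose ends (z : G * G) := [set z.1; z.2].
have edgesE : induced_edges A = ends @: D.
  apply/setP=> e; rewrite inE; apply/andP/imsetP.
    case=> /imset2P[x y _]; rewrite !inE /= => xy ->.
    rewrite subUset !sub1set => /andP[xA yA].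
    by exists (x, y); rewrite ?inE //= xA yA.
  case=> -[x y]; rewrite inE /= => /and3P[xA yA xy] ->; split.
    by apply/imset2P; exists x y; rewrite ?inE.
  by rewrite subUset !sub1set xA.
have -> : \sum_(x in A) \sum_(y in A) adj x y = #|D|.
  rewrite pair_big /= -sum1_card big_mkcond [RHS]big_mkcond /=.
  by apply: eq_bigr => -[x y] _; rewrite inE /=; do 2!case: (_ \in A); case: adj.
rewrite -[RHS]sum1_card (partition_big_imset ends) /=.
rewrite -edgesE -muln2 -sum_nat_const.
apply: eq_bigr => e; rewrite edgesE => /imsetP[[x y]].
rewrite inE /= => /and3P[xA yA xy] ->; rewrite sum1_card.
have xNy : x != y by apply: contraTneq xy => ->; rewrite adj_irr.
have -> : 2 = #|[set (x, y); (y, x)]| by rewrite cards2 xpair_eqE negb_and xNy.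
apply: eq_card => -[v w]; rewrite !inE /= !xpair_eqE; apply/idP/idP.
  move=> /orP[] /andP[/eqP-> /eqP->]; rewrite unfold_in inE /=.
    by rewrite xA yA xy eqxx.
  by rewrite xA yA adj_sym xy /ends /= setUC eqxx.
rewrite unfold_in inE /= => /andP[/and3P[_ _ vw] /eqP vwE].
have vNw : v != w by apply: contraTneq vw => ->; rewrite adj_irr.
have : w \in [set x; y] by rewrite -[[set x; y]]vwE set22.
have : v \in [set x; y] by rewrite -[[set x; y]]vwE set21.
by move: vNw => /[swap] /set2P[]-> /[swap] /set2P[]->; rewrite ?eqxx ?orbT.
Qed.

Definition clique_part d b (A : {set hyperbanana d b}) (s : bool) : {set 'I_d} :=
  [set i | (inl (s, i) : hyperbanana d b) \in A].

Definition banana_part d b (A : {set hyperbanana d b}) : {set 'I_b} :=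
  [set u | (inr u : hyperbanana d b) \in A].

Lemma hyperbanana_sum d b (A : {set hyperbanana d b})
    (F : hyperbanana d b -> nat) :
  \sum_(x in A) F x =
  \sum_s \sum_(i in clique_part A s) F (inl (s, i))
  + \sum_(u in banana_part A) F (inr u).
Proof.
rewrite big_mkcond big_sumType /=; congr (_ + _); last first.
  by rewrite [RHS]big_mkcond; apply: eq_bigr => u _; rewrite inE.
under [RHS]eq_bigr => s _ do rewrite big_mkcond.
by rewrite pair_bigA; apply: eq_bigr => -[s i] _; rewrite inE.
Qed.

Lemma hyperbanana_card d b (A : {set hyperbanana d b}) :
  #|A| = #|clique_part A true| + #|clique_part A false| + #|banana_part A|.
Proof.
by rewrite -sum1_card hyperbanana_sum big_bool /= !sum1_card.
Qed.

(** A clique vertex of [A] is adjacent in [A] to the rest of its own clique and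
    to all banana vertices, a banana vertex to the vertices of both cliques. *)
Lemma hyperbanana_card_induced_edgesD d b (A : {set hyperbanana d b})
    (p := #|clique_part A true|) (q := #|clique_part A false|)
    (u := #|banana_part A|) :
  #|induced_edges A|.*2 = p * p.-1 + q * q.-1 + 2 * (u * (p + q)).
Proof.
have deg_clique s i : i \in clique_part A s ->
    \sum_(y in A) adj (inl (s, i) : hyperbanana d b) y
    = #|clique_part A s|.-1 + u.
  move=> iA; rewrite hyperbanana_sum /= sum_nat_const muln1; congr (_ + _).
  rewrite (bigD1 s) //= [X in _ + X]big1 ?addn0; last first.
    move=> t /negPf ts; apply: big1 => j _; by rewrite eq_sym ts.
  rewrite (bigD1 i) //= !eqxx /= add0n (cardD1 i) iA /= -sum1_card.
  by apply: eq_big => [j|j /andP[_ ji]]; rewrite ?inE 1?andbC // eq_sym ji.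
have deg_banana v :
    \sum_(y in A) adj (inr v : hyperbanana d b) y = p + q.
  by rewrite hyperbanana_sum /= big_bool /= !sum_nat_const !muln1 muln0 addn0.
rewrite card_induced_edgesD hyperbanana_sum.
under [X in _ + X]eq_bigr => v _ do rewrite deg_banana.
under eq_bigr => s _ do under eq_bigr => i iA do rewrite deg_clique //.
rewrite big_bool /= !sum_nat_const -/p -/q -/u; nia.
Qed.

Lemma mul_predn_int (n : nat) : ((n * n.-1)%:Z = n%:Z * (n%:Z - 1))%R.
Proof. case: n => [|n] //=; lia. Qed.

Lemma bin2S_int (n : nat) : (2 * 'C(n.+1, 2)%:Z = n%:Z * (n%:Z + 1))%R.
Proof.
have := mul_bin_diag n.+1 1; rewrite bin1; lia.
Qed.

Section Slack.
Local Open Scope ring_scope.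

(** The numbers are integers because [d - p - q] takes both signs; each
    sign has its own expansion of the slack into nonnegative products. *)
Lemma hyperbanana_slack_ge0 (b d p q u : int) :
  d = 2 * b - 1 -> 0 <= p <= d -> 0 <= q <= d -> u <= b -> d <= p + q + u ->
  p * (p - 1) + q * (q - 1) + 2 * (u * (p + q))
    <= 2 * (d * (p + q + u)) - d * (d + 1).
Proof.
move=> dE /andP[p0 pd] /andP[q0 qd] ub dA; rewrite -subr_ge0.
have [dpq|pqd] := lerP d (p + q).
- (* Expansion around u = b. *)
  have -> : 2 * (d * (p + q + u)) - d * (d + 1)
      - (p * (p - 1) + q * (q - 1) + 2 * (u * (p + q)))
    = p * (d - p) + q * (d - q) + 2 * ((b - u) * (p + q - d)).
    by rewrite dE; ring.
  by rewrite !addr_ge0 ?mulr_ge0 ?subr_ge0.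
- (* Expansion around u = d - p - q.  The product k * (k - 1) with
     k = d - p - q is nonnegative since k is a positive integer. *)
  have -> : 2 * (d * (p + q + u)) - d * (d + 1)
      - (p * (p - 1) + q * (q - 1) + 2 * (u * (p + q)))
    = (d - p - q) * (d - p - q - 1) + 2 * (p * q)
      + 2 * ((p + q + u - d) * (d - p - q)).
    by ring.
  by rewrite !addr_ge0 ?mulr_ge0 //; lia.
Qed.

End Slack.

Theorem theorem10 (b d : nat) (hb : (1 <= b)%N) (hd : d = (2 * b - 1)%N) :
  maxwell_graph d (hyperbanana d b).
Proof.
have edgesZ (A : {set hyperbanana d b}) := congr1 Posz
  (hyperbanana_card_induced_edgesD A).
have binZ := bin2S_int d.
have dE : (d%:Z = 2 * b%:Z - 1)%R by lia.
split.
- have := edgesZ [set: hyperbanana d b].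
  have cliqueT s : #|clique_part [set: hyperbanana d b] s| = d.
    by rewrite -[RHS]card_ord; apply: eq_card => i; rewrite !inE.
  have bananaT : #|banana_part [set: hyperbanana d b]| = b.
    by rewrite -[RHS]card_ord; apply: eq_card => i; rewrite !inE.
  rewrite induced_edgesT -cardsT hyperbanana_card !cliqueT bananaT => eE.
  have := mul_predn_int d; nia.
- move=> A dA; have := edgesZ A; move: dA; rewrite hyperbanana_card.
  have pd s : #|clique_part A s| <= d by rewrite -[X in _ <= X]card_ord max_card.
  have ub : #|banana_part A| <= b by rewrite -[X in _ <= X]card_ord max_card.
  move: (pd true) (pd false) ub (mul_predn_int #|clique_part A true|)
    (mul_predn_int #|clique_part A false|).
  move: #|clique_part A true| #|clique_part A false| #|banana_part A|.
  move=> p q u pd' qd ub pE qE dA eE.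
  have := @hyperbanana_slack_ge0 b d p q u dE; lia.
Qed.
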